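(* Let $q_\varepsilon(t)$ be a space change of the trajectory $t\mapsto q(t)$, $t\in I$, and let $a,b\in I$. If $q(t)$ is a solution to the Lagrange equations, then $$\frac{\partial A_{a,b}(q_\varepsilon)}{\partial\varepsilon}\Big|_{\varepsilon=0}=\partial_{\dot q}L\bigl(t,q(t),\dot q(t)\bigr)\cdot\partial_\varepsilon q_\varepsilon(t)\Big|_{\varepsilon=0,\,t=b}-\partial_{\dot q}L\bigl(t,q(t),\dot q(t)\bigr)\cdot\partial_\varepsilon q_\varepsilon(t)\Big|_{\varepsilon=0,\,t=a}.$$
   Context: Let $n\ge1$ and let $L=L(t,q,\dot q)$ (the Lagrangian) be a smooth real-valued function on an open subset of $\mathbb{R}\times\mathbb{R}^n\times\mathbb{R}^n$. The symbols $\partial_qL,\partial_{\dot q}L$ denote the gradients with respect to the second and third arguments, viewed as vectors of $\mathbb{R}^n$; $x\cdot y$ is the Euclidean inner product; a dot over a function denotes the derivative in $t$. Let $t\mapsto q(t)\in\mathbb{R}^n$ be a smooth trajectory on an open interval $I$ such that $(t,q(t),\dot q(t))$ lies in the domain of $L$ for all $t\in I$. It is a solution to the Lagrange equations if $\frac{d}{dt}\partial_{\dot q}L(t,q(t),\dot q(t))-\partial_qL(t,q(t),\dot q(t))=0$ for all $t\in I$. A space change of $q$ is a smooth one-parameter family $(\varepsilon,t)\mapsto q_\varepsilon(t)\in\mathbb{R}^n$, defined on an open neighbourhood of $\{0\}\times I$ in $\mathbb{R}\times I$ (i.e. for $t\in I$ and $\varepsilon$ close to $0$), with $q_0(t)=q(t)$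 for all $t\in I$. The Hamiltonian action is $A_{a,b}(q)=\int_a^bL(t,q(t),\dot q(t))\,dt$. *)

(* Defs.v *)
From HB Require Import structures.
From mathcomp Require Import all_boot all_order all_algebra.
From mathcomp Require Import all_classical all_reals all_analysis.

Set Implicit Arguments.
Unset Strict Implicit.
Unset Printing Implicit Defensive.

Import Order.TTheory GRing.Theory Num.Theory.
Import numFieldNormedType.Exports.
Local Open Scope classical_set_scope.
Local Open Scope ring_scope.

(* Functions defined on an open set [U] are represented by total functions;
   for open [U], [Ck_on] and [smooth_on] only depend on the values on [U],
   since continuity, differentiability and ['D_v f x] are local notions.
   On finite-dimensional [V], the only case used, this is C^k in the usual
   sense: the partial derivatives are the ['D_v] for [v] in a basis. *)
Fixpoint Ck_on (R : realType) (V W : normedModType R) (k : nat)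
    (U : set V) (f : V -> W) : Prop :=
  match k with
  | 0 => forall x, U x -> {for x, continuous f}
  | k'.+1 => (forall x, U x -> differentiable f x) /\
             (forall v : V, Ck_on k' U (fun x => 'D_v f x))
  end.

Definition smooth_on (R : realType) (V W : normedModType R)
    (U : set V) (f : V -> W) : Prop := forall k, Ck_on k U f.

Definition gradient (R : realType) (n : nat) (g : 'rV[R]_n -> R)
    (x : 'rV[R]_n) : 'rV[R]_n := \row_i 'D_(delta_mx 0 i) g x.

Definition inner (R : realType) (n : nat) (x y : 'rV[R]_n) : R :=
  \sum_i x 0 i * y 0 i.

Definition grad_q (R : realType) (n : nat)
    (L : R -> 'rV[R]_n -> 'rV[R]_n -> R) (t : R) (x v : 'rV[R]_n) : 'rV[R]_n :=
  gradient (fun y => L t y v) x.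

Definition grad_dq (R : realType) (n : nat)
    (L : R -> 'rV[R]_n -> 'rV[R]_n -> R) (t : R) (x v : 'rV[R]_n) : 'rV[R]_n :=
  gradient (fun w => L t x w) v.

Definition lagrange_solution (R : realType) (n : nat)
    (L : R -> 'rV[R]_n -> 'rV[R]_n -> R) (I : set R) (q : R -> 'rV[R]_n) : Prop :=
  forall t, I t ->
    derive1 (fun s => grad_dq L s (q s) (derive1 q s)) t
      - grad_q L t (q t) (derive1 q t) = 0.

(* [qe e t] is q_e(t); only its values on the neighbourhood [W] matter. *)
Definition space_change (R : realType) (n : nat) (I : set R)
    (q : R -> 'rV[R]_n) (qe : R -> R -> 'rV[R]_n) : Prop :=
  exists W : set (R * R),
    [/\ open W,
        [set 0] `*` I `<=` W,
        W `<=` setT `*` I,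
        smooth_on W (fun p : R * R => qe p.1 p.2) &
        forall t, I t -> qe 0 t = q t].

(* Oriented integral: no order is assumed between the endpoints. *)
Definition oriented_integral (R : realType) (a b : R) (f : R -> R) : R :=
  if a <= b then \int[lebesgue_measure]_(t in `[a, b]) f t
  else - \int[lebesgue_measure]_(t in `[b, a]) f t.

Definition hamiltonian_action (R : realType) (n : nat)
    (L : R -> 'rV[R]_n -> 'rV[R]_n -> R) (a b : R) (q : R -> 'rV[R]_n) : R :=
  oriented_integral a b (fun t => L t (q t) (derive1 q t)).

(* Main.v *)
Require Import Defs.
From HB Require Import structures.
From mathcomp Require Import all_boot all_order all_algebra.
From mathcomp Require Import all_classical all_reals all_analysis.
From mathcomp Require Import ring.

(** The first variation formula is the integral of a total derivative.  Write
    [velocity] and [variation] for the derivatives of the family [q_e(t)] in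
    [t] and in [e].  On the open set of points [(e, t)] where the family is
    smooth and its jet [(t, q_e(t), velocity)] lies in the domain of [L], the
    chain rule gives the [e]-derivative of the Lagrangian along the family,
    [lagrangian_variation]:
      [grad_q L . variation + grad_dq L . d/de velocity].
    This function is jointly continuous, so on a compact segment of times it is
    bounded uniformly for [e] near [0]; dominated differentiation under the
    integral sign ([is_derive_under_integral]) then makes its integral the
    derivative of the action ([is_derive_action]).

    At [e = 0] the trajectory solves the Lagrange equations, hence
    [grad_q L = d/dt grad_dq L]; and the mixed derivatives of the family
    commute ([mixed_derive_sym]), hence [d/de velocity = d/dt variation].  The
    integrand is therefore [d/dt (grad_dq L . variation)], by the product rule
    ([is_derive_momentum_variation]), and the fundamental theorem of calculus
    leaves the two boundary terms.  When [b < a] the oriented integral is the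
    opposite of an ordinary one, and so is the difference of boundary terms. *)

Import Order.TTheory GRing.Theory Num.Theory.
Import numFieldNormedType.Exports.
Local Open Scope classical_set_scope.
Local Open Scope ring_scope.
Set Implicit Arguments.
Unset Strict Implicit.
Unset Printing Implicit Defensive.

(** * Symmetry of mixed directional derivatives *)

(** The two sides are limits of the same difference quotients, whether or
    not they converge.  This identifies partial derivatives with
    directional derivatives of uncurried functions. *)
Lemma derive_comp_affine (R : realType) (V1 V W : normedModType R)
    (c : V1 -> V) (g : V -> W) (x u : V1) (v : V) :
  (forall h, c (h *: u + x) = h *: v + c x) ->
  'D_u (g \o c) x = 'D_v g (c x).
Proof.
move=> cE; rewrite /derive.
have -> // : (fun h => h^-1 *: ((g \o c \o shift x) (h *: u) - (g \o c) x))
           = (fun h => h^-1 *: ((g \o shift (c x)) (h *: v) - g (c x))).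
by apply/funext => h /=; rewrite cE.
Qed.

Lemma is_derive_comp_affine (R : realType) (V1 V W : normedModType R)
    (c : V1 -> V) (g : V -> W) (x u : V1) (v : V) (dg : W) :
  (forall h, c (h *: u + x) = h *: v + c x) ->
  is_derive (c x) v g dg -> is_derive x u (g \o c) dg.
Proof.
move=> cE [dgx gE]; split; last by rewrite (derive_comp_affine _ cE).
move: dgx; rewrite /derivable.
have -> // : (fun h => h^-1 *: ((g \o c \o shift x) (h *: u) - (g \o c) x))
           = (fun h => h^-1 *: ((g \o shift (c x)) (h *: v) - g (c x))).
by apply/funext => h /=; rewrite cE.
Qed.

Lemma differentiable_expansion (R : realType) (V W : normedModType R)
    (f : V -> W) (x : V) (e : R) : differentiable f x -> 0 < e ->
  \forall y \near (0 : V), `|f (y + x) - f x - 'd f x y| <= e * `|y|.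
Proof.
move=> df e0.
have /diff_locallyP[_ /eqaddoP/(_ e e0)] := df.
by apply: filterS => y; rewrite /= !fctE /= opprD addrA.
Qed.

Lemma MVT_from0 (R : realType) (f df : R -> R) (h : R) : 0 < h ->
  (forall s, 0 <= s <= h -> is_derive s 1 f (df s)) ->
  exists2 s, 0 <= s <= h & f h - f 0 = df s * h.
Proof.
move=> h0 fd.
have [||s] := @MVT_segment R f df 0 h (ltW h0).
- by move=> r; rewrite in_itv/= => /andP[r0 rh]; apply: fd; rewrite !ltW.
- apply: derivable_within_continuous => s; rewrite in_itv/= => sh.
  by have [] := fd s sh.
- by rewrite in_itv/= subr0 => sh E; exists s.
Qed.

(** Along [s], the function [f (s u + h v + x) - f (s u + x)] has derivative
    [g (s u + h v + x) - g (s u + x)], which differs from [h 'D_v g x] by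
    [o(h)] uniformly in [s <= h] because [g] is differentiable at [x].  The mean
    value theorem multiplies this by [h]. *)
Lemma second_difference (R : realType) (V : normedModType R) (f g : V -> R)
    (x u v : V) (e : R) :
  (\forall y \near x, is_derive y u f (g y)) -> differentiable g x ->
  0 < e ->
  \forall h \near 0^'+,
    `|f (h *: u + h *: v + x) - f (h *: u + x) - f (h *: v + x) + f x
      - h ^+ 2 * 'D_v g x| <= e * h ^+ 2.
Proof.
move=> df dg e0.
(* Both points at which [g] is compared with its linearization stay within
   [h * N] of [x], and [e' * (2 * N) <= e]. *)
set N := `|u| + `|v|.
have N0 : 0 <= N by rewrite addr_ge0.
set e' := e / (2 * N + 1).
have N1 : 0 < 2 * N + 1 by rewrite ltr_wpDl // mulr_ge0.
have e'0 : 0 < e' by rewrite divr_gt0.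
have df0 := df; rewrite (near_shift 0) in df0.
have : \forall y \near (0 : V), is_derive (y + x) u f (g (y + x)) /\
    `|g (y + x) - g x - 'd g x y| <= e' * `|y|.
  apply: filterI; last exact: differentiable_expansion.
  by move: df0; apply: filterS => y /=; rewrite subr0.
move=> /nbhs_norm0P[d /= d0 Pd].
near=> h.
have h0 : 0 < h by near: h; exact: nbhs_right_gt.
have hd : h * N < d.
  rewrite (@le_lt_trans _ _ (h * (N + 1))) ?ler_wpM2l ?lerDl ?(ltW h0)//.
  rewrite -ltr_pdivlMr ?ltr_wpDl//.
  by near: h; apply: nbhs_right_lt; rewrite divr_gt0 ?ltr_wpDl.
have bnd s : 0 <= s <= h ->
    `|s *: u + h *: v| <= h * N /\ `|s *: u| <= h * N.
  move=> /andP[s0 sh].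
  have su : `|s *: u| <= h * `|u|.
    by rewrite normrZ ger0_norm// ler_wpM2r.
  split; rewrite /N mulrDr.
    by rewrite (le_trans (ler_normD _ _))// lerD// normrZ gtr0_norm.
  by rewrite (le_trans su)// lerDl mulr_ge0// ltW.
have small s : 0 <= s <= h -> `|s *: u + h *: v| < d /\ `|s *: u| < d.
  move=> /bnd[b1 b0].
  by split; [apply: le_lt_trans b1 _|apply: le_lt_trans b0 _].
pose phi s := f (s *: u + h *: v + x) - f (s *: u + x).
have [s sh phiE] : exists2 s, 0 <= s <= h & phi h - phi 0 =
    (g (s *: u + h *: v + x) - g (s *: u + x)) * h.
  apply: (@MVT_from0 R phi) => // s /small[/Pd[d1 _] /Pd[d0' _]].
  apply: is_deriveB.
    apply: (@is_derive_comp_affine R R V R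
      (fun s => s *: u + h *: v + x) f s 1 u) => //.
    by move=> k; rewrite scalerDl [k *: 1]mulr1 !addrA.
  apply: (@is_derive_comp_affine R R V R (fun s => s *: u + x) f s 1 u) => //.
  by move=> k; rewrite scalerDl [k *: 1]mulr1 !addrA.
have /small[/Pd[_ E1] /Pd[_ E0]] := sh.
have [b1 b0] := bnd s sh.
have -> : f (h *: u + h *: v + x) - f (h *: u + x) - f (h *: v + x) + f x
    = phi h - phi 0 by rewrite /phi !scale0r !add0r opprD opprK !addrA.
rewrite phiE.
rewrite (deriveE v dg).
set A := g (s *: u + h *: v + x).
set B := g (s *: u + x).
have -> : (A - B) * h - h ^+ 2 * 'd g x v =
  h * ((A - g x - 'd g x (s *: u + h *: v)) -
       (B - g x - 'd g x (s *: u))).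
  by rewrite linearD /= (linearZ _ v)/= /GRing.scale/=; ring.
rewrite normrM gtr0_norm// expr2 mulrCA ler_wpM2l ?(ltW h0)//.
apply: le_trans (ler_normB _ _) _.
apply: le_trans (lerD E1 E0) _.
rewrite -mulrDr.
apply: (@le_trans _ _ (e' * (h * (2 * N + 1)))).
  rewrite ler_wpM2l ?(ltW e'0)//.
  apply: le_trans (lerD b1 b0) _.
  by rewrite -mulrDr ler_wpM2l ?(ltW h0)// mulr_natl mulr2n lerDl.
by rewrite /e' mulrCA divfK ?gt_eqF// mulrC.
Unshelve. all: by end_near. Qed.

(** The second difference of [second_difference] is symmetric in [u] and [v],
    so both mixed derivatives are its limit after division by [h ^+ 2].  The
    first derivatives enter as functions [gu] and [gv] that agree with them near
    [x], in order to take for [gu] a coordinate of ['D_u f] when [f] is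
    vector-valued: where [f] is not differentiable, this need not be the
    derivative of that coordinate of [f]. *)
Lemma mixed_derive_sym (R : realType) (V : normedModType R)
    (f gu gv : V -> R) (x u v : V) :
  (\forall y \near x, is_derive y u f (gu y)) ->
  (\forall y \near x, is_derive y v f (gv y)) ->
  differentiable gu x -> differentiable gv x -> 'D_v gu x = 'D_u gv x.
Proof.
move=> du dv dgu dgv; apply/eqP.
rewrite -subr_eq0 -normr_le0; apply/ler_addgt0Pl => e e0; rewrite addr0.
have e20 : 0 < e / 2 by rewrite divr_gt0.
have Du := @second_difference R V f gu x u v _ du dgu e20.
have Dv := @second_difference R V f gv x v u _ dv dgv e20.
have [h [[/= h0 Eu] Ev]] :=
  @filter_ex _ _ _ _ (filterI (filterI (nbhs_right_gt (0 : R)) Du) Dv).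
have h2 : 0 < h ^+ 2 by rewrite exprn_gt0.
rewrite (addrC (h *: v)) (addrAC (f _) (- f (h *: v + x))) in Ev.
set S := (f _ - _ - _ + _) in Eu Ev.
move: ('D_v gu x) ('D_u gv x) S Eu Ev => A B S Eu Ev.
rewrite -(ler_pM2l h2) -[X in X * `|_|](gtr0_norm h2) -normrM.
have -> : h ^+ 2 * (A - B) = (S - h ^+ 2 * B) - (S - h ^+ 2 * A) by ring.
apply: le_trans (ler_normB _ _) _.
by rewrite (le_trans (lerD Ev Eu))// -mulrDl -splitr mulrC.
Qed.

Lemma derive_coord (R : realType) (V : normedModType R) n (f : V -> 'rV[R]_n)
    (x v : V) (df : 'rV[R]_n) i :
  is_derive x v f df -> is_derive x v (fun y => f y 0 i) (df 0 i).
Proof.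
move=> [fx <-]; split; first by have /derivable_mxP := fx.
by rewrite derive_mx // mxE.
Qed.

Lemma mixed_derive_sym_rV (R : realType) (V : normedModType R) n
    (f gu gv : V -> 'rV[R]_n) (x u v : V) :
  (\forall y \near x, is_derive y u f (gu y)) ->
  (\forall y \near x, is_derive y v f (gv y)) ->
  differentiable gu x -> differentiable gv x -> 'D_v gu x = 'D_u gv x.
Proof.
move=> du dv dgu dgv.
have coordE w (g : V -> 'rV[R]_n) i : differentiable g x ->
    ('D_w g x) 0 i = 'D_w (fun y => g y 0 i) x.
  move=> dg; apply/esym; have dgw : is_derive x w g ('D_w g x).
    by split => //; exact: diff_derivable.
  by have [] := derive_coord i dgw.
apply/rowP => i; rewrite (coordE v _ i dgu) (coordE u _ i dgv).
apply: (@mixed_derive_sym R V (fun y => f y 0 i)).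
- by apply: filterS du => y; exact: derive_coord.
- by apply: filterS dv => y; exact: derive_coord.
- exact: (differentiable_comp dgu (differentiable_coord _ _ _)).
- exact: (differentiable_comp dgv (differentiable_coord _ _ _)).
Qed.

(** * Integrals of continuously differentiable functions *)

(** A constant dominates the derivative: [`|F' x t|] has a maximum over
    [`[a, b]], and by the tube lemma this maximum plus [1] still bounds
    [`|F' e t|] for all [t] in [`[a, b]] once [e] is close to [x]. *)
Lemma is_derive_under_integral (R : realType) (F F' : R -> R -> R)
    (W : set (R * R)) (a b x : R) : a <= b -> open W ->
  (forall t, a <= t <= b -> W (x, t)) ->
  (forall e t, W (e, t) -> is_derive e 1 (F ^~ t) (F' e t)) ->
  (forall p, W p -> {for p, continuous (fun p => F p.1 p.2)}) ->
  (forall p, W p -> {for p, continuous (fun p => F' p.1 p.2)}) ->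
  is_derive x 1 (fun e => \int[lebesgue_measure]_(t in `[a, b]) F e t)
    (\int[lebesgue_measure]_(t in `[a, b]) F' x t).
Proof.
move=> ab Wo Wx dF cF cF'.
have slice (G : R -> R -> R) e :
    (forall p, W p -> {for p, continuous (fun p => G p.1 p.2)}) ->
    (forall t, a <= t <= b -> W (e, t)) ->
    {within `[a, b], continuous (G e)}.
  move=> cG We; apply: continuous_in_subspaceT => t.
  rewrite inE/= in_itv/= => /We/cG.
  move=> /(@continuous_comp _ _ _ (fun t => (e, t)) _ t).
  apply.
  by apply: (@cvg_pair _ _ _ _ _ _ _ _ _ (cst e) id (cvg_cst _) cvg_id).
have [c cab Mc] : exists2 c, c \in `[a, b] &
    forall t, t \in `[a, b] -> `|F' x t| <= `|F' x c|.
  apply: (@EVT_max R (fun t => `|F' x t|)) => // t.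
  exact: (continuous_comp (slice F' x cF' Wx t) (@norm_continuous _ _ _)).
have tube : \forall e \near x,
    `[a, b]%classic `<=` (fun t => W (e, t) /\ `|F' e t| <= `|F' x c| + 1).
  have /compact_near_coveringP cover := @segment_compact R a b.
  apply: (cover R (nbhs x) (fun e t => W (e, t) /\ `|F' e t| <= `|F' x c| + 1)).
  move=> t tab.
  (* The parameter comes first in [W] but last in the covering lemma. *)
  suff H : \forall e \near x & t' \near t,
      W (e, t') /\ `|F' e t'| <= `|F' x c| + 1.
    case: H => -[A B] [/= Ax Bt] AB; exists (B, A) => // -[t' e] [/= Bt' Ae].
    exact: (AB (e, t')).
  have Wxt : W (x, t) by apply: Wx; move: tab; rewrite /= in_itv.
  have lt : `|F' x t| < `|F' x c| + 1.
    by rewrite (le_lt_trans (Mc t tab))// ltrDl.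
  have nW := open_nbhs_nbhs (conj Wo Wxt).
  have nF' := @cvgr_norm_le _ _ _ _ _ _ _ (cF' _ Wxt) _ lt.
  have : \forall p \near (x, t), W p /\ `|F' p.1 p.2| <= `|F' x c| + 1.
    by apply: filterI; [exact: nW|exact: nF'].
  by case=> AB nAB ABs; exists AB => // -[e t'] /ABs.
have /nbhs_ballP[d /= d0 Wd] := tube.
have Idx e : `]x - d, x + d[%classic e -> `[a, b]%classic `<=`
    (fun t => W (e, t) /\ `|F' e t| <= `|F' x c| + 1).
  by rewrite -ball_itv => /Wd.
have Ix : `]x - d, x + d[%classic x by rewrite -ball_itv; exact: ballxx.
have mab := @measurable_itv R `[a, b].
have intF e : `]x - d, x + d[%classic e ->
    lebesgue_measure.-integrable `[a, b]%classic (EFin \o F e).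
  move=> /Idx We; apply: continuous_compact_integrable.
    exact: segment_compact.
  by apply: slice => // t tab; have [] := We t; rewrite //= in_itv.
have dFI e t : `]x - d, x + d[%classic e -> `[a, b]%classic t ->
    is_derive e 1 (F ^~ t) (F' e t).
  by move=> /Idx We /We[Wet _]; exact: dF.
have pF e t : `]x - d, x + d[%classic e -> `[a, b]%classic t ->
    derivable (F ^~ t) e 1 by move=> Ie It; have [] := dFI e t Ie It.
have intM : lebesgue_measure.-integrable `[a, b]%classic
    (EFin \o cst (`|F' x c| + 1)).
  apply: continuous_compact_integrable; first exact: segment_compact.
  by apply: continuous_subspaceT; exact: cst_continuous.
have M0 (t : R) : 0 <= cst (`|F' x c| + 1) t by rewrite addr_ge0.
have bF e t : `]x - d, x + d[%classic e -> `[a, b]%classic t ->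
    `|partial1of2 F e t| <= cst (`|F' x c| + 1) t.
  move=> Ie It.
  rewrite partial1of2E (@derive_val _ _ _ _ _ _ _ (dFI e t Ie It)).
  by have [] := Idx e Ie t It.
split.
  exact: (@derivable_under_integral R _ _ lebesgue_measure F _ mab
    x (x - d) (x + d) Ix intF pF _ M0 intM bF).
rewrite -derive1E (@differentiation_under_integral R _ _ lebesgue_measure F
  _ mab x (x - d) (x + d) Ix intF pF _ M0 intM bF).
apply: eq_Rintegral => t; rewrite inE => tab.
by rewrite partial1of2E (@derive_val _ _ _ _ _ _ _ (dFI x t Ix tab)).
Qed.

(** Two-sided differentiability at [a] and [b] makes [G] continuous there, which
    supplies the one-sided limits asked for by [continuous_FTC2]. *)
Lemma Rintegral_derivative (R : realType) (G g : R -> R) (a b : R) : a <= b ->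
  (forall t, a <= t <= b -> is_derive t 1 G (g t)) ->
  (forall t, a <= t <= b -> {for t, continuous g}) ->
  \int[lebesgue_measure]_(t in `[a, b]) g t = G b - G a.
Proof.
rewrite le_eqVlt => /predU1P[<- _ _|ab dG cg].
  by rewrite set_itv1 Rintegral_set1 subrr.
have cG t : a <= t <= b -> {for t, continuous G}.
  move=> /dG[dGt _]; apply: differentiable_continuous; exact/derivable1_diffP.
rewrite /Rintegral (@continuous_FTC2 R g G a b ab)//.
- apply: continuous_in_subspaceT => t; rewrite inE/= in_itv/=; exact: cg.
- split.
  + move=> t; rewrite in_itv/= => /andP[ta tb].
    by have [|//] := dG t; rewrite !ltW.
  + by apply: cvg_at_right_filter; apply: cG; rewrite lexx ltW.
  + by apply: cvg_at_left_filter; apply: cG; rewrite lexx ltW.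
- move=> t; rewrite in_itv/= => /andP[ta tb].
  by rewrite derive1E; have [|] := dG t; rewrite ?ltW.
Qed.

(** * Calculus of Lagrangians *)

Lemma is_derive_inner (R : realType) (V : normedModType R) n
    (f g : V -> 'rV[R]_n) (x v : V) (df dg : 'rV[R]_n) :
  is_derive x v f df -> is_derive x v g dg ->
  is_derive x v (fun y => inner (f y) (g y)) (inner df (g x) + inner (f x) dg).
Proof.
move=> dfx dgx.
have -> : (fun y => inner (f y) (g y)) =
    \sum_(i < n) ((fun y => f y 0 i) * (fun y => g y 0 i)).
  by apply/funext => y; rewrite fct_sumE.
rewrite /inner -big_split /=; apply: is_derive_sum => i.
have dfi := derive_coord i dfx; have dgi := derive_coord i dgx.
have dM := is_deriveM dfi dgi.
by apply: is_derive_eq; rewrite addrC /GRing.scale/= [df 0 i * _]mulrC.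
Qed.

Lemma cvg_inner (R : realType) (T : Type) (F : set_system T) n
    (f g : T -> 'rV[R]_n) (a b : 'rV[R]_n) : Filter F ->
  (forall i, (fun y => f y 0 i) @ F --> a 0 i) ->
  (forall i, (fun y => g y 0 i) @ F --> b 0 i) ->
  (fun y => inner (f y) (g y)) @ F --> inner a b.
Proof.
move=> FF fa gb; by apply: (cvg_big add_continuous) => i _; apply: cvgM.
Qed.

(** Linearity is a plain hypothesis, so that this applies to the differential
    composed with an inclusion of one factor of the domain of [L]. *)
Lemma linear_inner (R : realType) n (f : 'rV[R]_n -> R) (u : 'rV[R]_n) :
  (forall k x y, f (k *: x + y) = k * f x + f y) ->
  f u = inner (\row_i f (delta_mx 0 i)) u.
Proof.
move=> fL.
have f0 : f 0 = 0.
  by have := fL (-1) 0 0; rewrite scaler0 addr0 mulN1r addNr.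
have fD : {morph f : x y / x + y >-> x + y}.
  by move=> x y; have := fL 1 x y; rewrite scale1r mul1r.
rewrite {1}(row_sum_delta u) (big_morph f fD f0); apply: eq_bigr => i _.
by rewrite mxE mulrC -[X in f X]addr0 fL f0 addr0.
Qed.

Definition uncurry3 (R : realType) n (L : R -> 'rV[R]_n -> 'rV[R]_n -> R) :=
  fun p : R * 'rV[R]_n * 'rV[R]_n => L p.1.1 p.1.2 p.2.

Lemma grad_qE (R : realType) n (L : R -> 'rV[R]_n -> 'rV[R]_n -> R) t x v i :
  grad_q L t x v 0 i = 'D_((0, delta_mx 0 i), 0) (uncurry3 L) (t, x, v).
Proof.
rewrite mxE.
apply: (@derive_comp_affine R _ _ _ (fun y => (t, y, v)) (uncurry3 L)) => h.
transitivity (h *: (0 : R) + t, h *: delta_mx 0 i + x, h *: (0 : 'rV[R]_n) + v).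
  by rewrite !scaler0 !add0r.
by [].
Qed.

Lemma grad_dqE (R : realType) n (L : R -> 'rV[R]_n -> 'rV[R]_n -> R) t x v i :
  grad_dq L t x v 0 i = 'D_((0, 0), delta_mx 0 i) (uncurry3 L) (t, x, v).
Proof.
rewrite mxE.
apply: (@derive_comp_affine R _ _ _ (fun w => (t, x, w)) (uncurry3 L)) => h.
transitivity (h *: (0 : R) + t, h *: (0 : 'rV[R]_n) + x, h *: delta_mx 0 i + v).
  by rewrite !scaler0 !add0r.
by [].
Qed.

(** [(0, u, w)] is [(0, u, 0) + (0, 0, w)], and each half is expanded in the
    canonical basis of its factor, where the differential takes the partial
    derivatives as values. *)
Lemma diff_uncurry3 (R : realType) n (L : R -> 'rV[R]_n -> 'rV[R]_n -> R)
    t x v u w : differentiable (uncurry3 L) (t, x, v) ->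
  'd (uncurry3 L) (t, x, v) (0, u, w) =
  inner (grad_q L t x v) u + inner (grad_dq L t x v) w.
Proof.
move=> dL; set D := 'd (uncurry3 L) (t, x, v).
have DE u' : D u' = 'D_u' (uncurry3 L) (t, x, v) by rewrite deriveE.
have -> : ((0, u, w) : R * 'rV[R]_n * 'rV[R]_n) = (0, u, 0) + (0, 0, w).
  transitivity ((0 : R) + 0, u + 0, 0 + w); last by [].
  by rewrite !addr0 add0r.
rewrite linearD; congr (_ + _).
- rewrite (@linear_inner R n (fun u => D (0, u, 0))); last first.
    move=> k y z; rewrite -linearP; congr (D _).
    transitivity (k *: (0 : R) + 0, k *: y + z, k *: (0 : 'rV[R]_n) + 0) => //.
    by rewrite !scaler0 !add0r.
  by congr inner; apply/rowP => i; rewrite mxE DE grad_qE.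
- rewrite (@linear_inner R n (fun w => D (0, 0, w))); last first.
    move=> k y z; rewrite -linearP; congr (D _).
    transitivity (k *: (0 : R) + 0, k *: (0 : 'rV[R]_n) + 0, k *: y + z) => //.
    by rewrite !scaler0 !add0r.
  by congr inner; apply/rowP => i; rewrite mxE DE grad_dqE.
Qed.

Lemma is_diff_is_derive1 (R : realType) (V : normedModType R) (f : R -> V)
    (e : R) (df : V) :
  is_derive e 1 f df -> is_diff e f ( *:%R^~ df).
Proof.
move=> [dfe <-]; apply: DiffDef; first exact/derivable1_diffP.
by rewrite deriv1E // derive1E.
Qed.

Lemma is_derive_uncurry3 (R : realType) n (L : R -> 'rV[R]_n -> 'rV[R]_n -> R)
    (x v : R -> 'rV[R]_n) (dx dv : 'rV[R]_n) (t e : R) :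
  differentiable (uncurry3 L) (t, x e, v e) ->
  is_derive e 1 x dx -> is_derive e 1 v dv ->
  is_derive e 1 (fun e => L t (x e) (v e))
    (inner (grad_q L t (x e) (v e)) dx + inner (grad_dq L t (x e) (v e)) dv).
Proof.
move=> dL /is_diff_is_derive1 Dx /is_diff_is_derive1 Dv.
pose c e := (t, x e, v e).
have Dc : is_diff e c (fun h => (0, h *: dx, h *: dv)).
  exact: (is_diff_pair (is_diff_pair (is_diff_cst t e) Dx) Dv).
have [dc cE] := Dc.
have dLc : differentiable (uncurry3 L \o c) e by exact: differentiable_comp.
have -> : (fun e => L t (x e) (v e)) = uncurry3 L \o c by [].
split; first exact: diff_derivable.
by rewrite deriveE // diff_comp //= cE !scale1r diff_uncurry3.
Qed.

(** * One-parameter families of trajectories *)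

Definition family (R : realType) n (qe : R -> R -> 'rV[R]_n) (p : R * R) :=
  qe p.1 p.2.

(** The time derivative, taken as a directional derivative on the plane so that
    it inherits joint smoothness in [(e, t)]; see [velocityE]. *)
Definition velocity (R : realType) n (qe : R -> R -> 'rV[R]_n) (p : R * R) :=
  'D_(0, 1) (family qe) p.

Definition variation (R : realType) n (qe : R -> R -> 'rV[R]_n) (p : R * R) :=
  'D_(1, 0) (family qe) p.

(** The derivative in [e] of [L (t, q_e(t), velocity)], as the chain rule gives
    it. *)
Definition lagrangian_variation (R : realType) n
    (L : R -> 'rV[R]_n -> 'rV[R]_n -> R) (qe : R -> R -> 'rV[R]_n)
    (e t : R) : R :=
  inner (grad_q L t (qe e t) (velocity qe (e, t))) (variation qe (e, t)) +
  inner (grad_dq L t (qe e t) (velocity qe (e, t)))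
    ('D_(1, 0) (velocity qe) (e, t)).

Lemma slice1E (R : realType) (t e h : R) :
  (h *: 1 + e, t) = h *: (1, 0) + (e, t).
Proof.
by transitivity (h *: (1 : R) + e, h *: (0 : R) + t);
  [rewrite scaler0 add0r|].
Qed.

Lemma slice2E (R : realType) (t e h : R) :
  (e, h *: 1 + t) = h *: (0, 1) + (e, t).
Proof.
by transitivity (h *: (0 : R) + e, h *: (1 : R) + t);
  [rewrite scaler0 add0r|].
Qed.

Lemma velocityE (R : realType) n (qe : R -> R -> 'rV[R]_n) e t :
  derive1 (qe e) t = velocity qe (e, t).
Proof.
rewrite derive1E; apply: (@derive_comp_affine _ _ _ _ (pair e) (family qe)).
by move=> h; rewrite slice2E.
Qed.

Lemma variationE (R : realType) n (qe : R -> R -> 'rV[R]_n) e t :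
  derive1 (fun e => qe e t) e = variation qe (e, t).
Proof.
rewrite derive1E; apply: (@derive_comp_affine _ _ _ _ (pair^~ t) (family qe)).
by move=> h; rewrite slice1E.
Qed.

Lemma is_derive_slice1 (R : realType) (V : normedModType R)
    (f : R * R -> V) e t :
  differentiable f (e, t) ->
  is_derive e 1 (fun e => f (e, t)) ('D_(1, 0) f (e, t)).
Proof.
move=> df; apply: (@is_derive_comp_affine _ _ _ _ (pair^~ t) f e 1 (1, 0)).
  by move=> h; rewrite slice1E.
by split => //; exact: diff_derivable.
Qed.

Lemma is_derive_slice2 (R : realType) (V : normedModType R)
    (f : R * R -> V) e t :
  differentiable f (e, t) ->
  is_derive t 1 (fun t => f (e, t)) ('D_(0, 1) f (e, t)).
Proof.
move=> df; apply: (@is_derive_comp_affine _ _ _ _ (pair e) f t 1 (0, 1)).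
  by move=> h; rewrite slice2E.
by split => //; exact: diff_derivable.
Qed.

Lemma smooth_differentiable (R : realType) (V W : normedModType R) (U : set V)
    (f : V -> W) x : smooth_on U f -> U x -> differentiable f x.
Proof. by move=> /(_ 1%N)[+ _]; exact. Qed.

Lemma smooth_derive (R : realType) (V W : normedModType R) (U : set V)
    (f : V -> W) v : smooth_on U f -> smooth_on U ('D_v f).
Proof. by move=> sf k; have [_ sfv] := sf k.+1; exact: sfv. Qed.

Lemma smooth_continuous (R : realType) (V W : normedModType R) (U : set V)
    (f : V -> W) x : smooth_on U f -> U x -> {for x, continuous f}.
Proof. by move=> /(_ 0%N); exact. Qed.

Lemma smooth_velocity (R : realType) n (W : set (R * R))
    (qe : R -> R -> 'rV[R]_n) :
  smooth_on W (family qe) -> smooth_on W (velocity qe).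
Proof. exact: smooth_derive. Qed.

Lemma smooth_variation (R : realType) n (W : set (R * R))
    (qe : R -> R -> 'rV[R]_n) :
  smooth_on W (family qe) -> smooth_on W (variation qe).
Proof. exact: smooth_derive. Qed.

Lemma continuous_coord (R : realType) (T : topologicalType) n
    (f : T -> 'rV[R]_n) x i : {for x, continuous f} ->
  {for x, continuous (fun y => f y 0 i)}.
Proof.
move=> fx; exact: (continuous_comp fx (@coord_continuous _ _ _ _ _ _)).
Qed.

Lemma continuous_pair (S T T' : topologicalType) (f : S -> T) (g : S -> T') x :
  {for x, continuous f} -> {for x, continuous g} ->
  {for x, continuous (fun y => (f y, g y))}.
Proof.
move=> fx gx.
exact: (@cvg_pair _ _ _ (nbhs x) (nbhs (f x)) (nbhs (g x)) _ _ _ f g fx gx).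
Qed.

(** The curve [t |-> jet qe (e, t)] is the lift of the trajectory [q_e] to the
    domain of the Lagrangian. *)
Definition jet (R : realType) n (qe : R -> R -> 'rV[R]_n) (p : R * R) :=
  (p.2, family qe p, velocity qe p).

Lemma continuous_jet (R : realType) n (W : set (R * R))
    (qe : R -> R -> 'rV[R]_n) p :
  smooth_on W (family qe) -> W p -> {for p, continuous (jet qe)}.
Proof.
move=> sq Wp; have sv := smooth_velocity sq.
have c2 : {for p, continuous (@snd R R)} by exact: cvg_snd.
exact: (continuous_pair (continuous_pair c2 (smooth_continuous sq Wp))
  (smooth_continuous sv Wp)).
Qed.

Lemma continuous_lagrangian_variation (R : realType) n
    (U : set (R * 'rV[R]_n * 'rV[R]_n)) (L : R -> 'rV[R]_n -> 'rV[R]_n -> R)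
    (W : set (R * R)) (qe : R -> R -> 'rV[R]_n) e t :
  smooth_on U (uncurry3 L) -> smooth_on W (family qe) ->
  W (e, t) -> U (jet qe (e, t)) ->
  {for (e, t), continuous (fun p => lagrangian_variation L qe p.1 p.2)}.
Proof.
move=> sL sq Wp Up; have sv := smooth_velocity sq.
have cD u : {for (e, t), continuous ('D_u (uncurry3 L) \o jet qe)}.
  have cDu := smooth_continuous (smooth_derive u sL) Up.
  exact: (continuous_comp (continuous_jet sq Wp) cDu).
have cF (f : R * R -> 'rV[R]_n) i : {for (e, t), continuous f} ->
    {for (e, t), continuous (fun p => f (p.1, p.2) 0 i)}.
  rewrite (_ : (fun p => _) = (fun p => f p 0 i)); last first.
    by apply/funext => -[].
  exact: continuous_coord.
apply: cvgD; apply: cvg_inner => i.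
- rewrite (_ : (fun p => _) =
      'D_((0, delta_mx 0 i), 0) (uncurry3 L) \o jet qe); last first.
    by apply/funext => -[e' t']; rewrite grad_qE.
  by rewrite grad_qE; exact: cD.
- exact: (cF _ _ (smooth_continuous (smooth_derive _ sq) Wp)).
- rewrite (_ : (fun p => _) =
      'D_((0, 0), delta_mx 0 i) (uncurry3 L) \o jet qe); last first.
    by apply/funext => -[e' t']; rewrite grad_dqE.
  by rewrite grad_dqE; exact: cD.
- exact: (cF _ _ (smooth_continuous (smooth_derive _ sv) Wp)).
Qed.

(** The points [(e, t)] whose jet lies in [U] form an open set, as jets are
    continuous, so the hypothesis at the single parameter [e] extends to the
    nearby parameters. *)
Lemma is_derive_action (R : realType) n
    (U : set (R * 'rV[R]_n * 'rV[R]_n)) (L : R -> 'rV[R]_n -> 'rV[R]_n -> R)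
    (W : set (R * R)) (qe : R -> R -> 'rV[R]_n) (a b e : R) :
  open U -> smooth_on U (uncurry3 L) -> open W -> smooth_on W (family qe) ->
  a <= b ->
  (forall t, a <= t <= b -> W (e, t) /\ U (jet qe (e, t))) ->
  is_derive e 1
    (fun e => \int[lebesgue_measure]_(t in `[a, b])
       L t (qe e t) (velocity qe (e, t)))
    (\int[lebesgue_measure]_(t in `[a, b]) lagrangian_variation L qe e t).
Proof.
move=> Uo sL Wo sq ab WUe; have sv := smooth_velocity sq.
pose W' := [set p | W p /\ U (jet qe p)].
have W'o : open W'.
  rewrite openE => p [Wp Up]; apply: filterI.
    exact: (open_nbhs_nbhs (conj Wo Wp)).
  by apply: (continuous_jet sq Wp); exact: (open_nbhs_nbhs (conj Uo Up)).
apply: (@is_derive_under_integral R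
    (fun e t => L t (qe e t) (velocity qe (e, t)))
    (lagrangian_variation L qe) W') => //.
- move=> e' t [Wet Uet].
  apply: (is_derive_uncurry3 (smooth_differentiable sL Uet)).
    exact: (is_derive_slice1 (smooth_differentiable sq Wet)).
  exact: (is_derive_slice1 (smooth_differentiable sv Wet)).
- move=> p [Wp Up].
  have cL := continuous_comp (continuous_jet sq Wp) (smooth_continuous sL Up).
  by rewrite (_ : (fun p => _) = uncurry3 L \o jet qe)//; apply/funext => -[].
- move=> [e' t] [Wp Up]; exact: continuous_lagrangian_variation sL sq Wp Up.
Qed.

(** The Lagrange equations give the value of the derivative of the conjugate
    momentum; that the derivative exists at all comes from the smoothness of
    [L] and [q]. *)
Lemma is_derive_momentum (R : realType) n
    (U : set (R * 'rV[R]_n * 'rV[R]_n)) (L : R -> 'rV[R]_n -> 'rV[R]_n -> R)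
    (I : set R) (q : R -> 'rV[R]_n) t :
  smooth_on U (uncurry3 L) -> smooth_on I q ->
  (forall t, I t -> U (t, q t, derive1 q t)) ->
  lagrange_solution L I q -> I t ->
  is_derive t 1 (fun s => grad_dq L s (q s) (derive1 q s))
    (grad_q L t (q t) (derive1 q t)).
Proof.
move=> sL sq qU sol It.
have dq : differentiable q t := smooth_differentiable sq It.
have dq' : differentiable (derive1 q) t.
  rewrite (_ : derive1 q = 'D_1 q); last by apply/funext => s; rewrite derive1E.
  exact: (smooth_differentiable (smooth_derive _ sq) It).
pose c s := (s, q s, derive1 q s).
have dc : differentiable c t.
  by apply: differentiable_pair => //; apply: differentiable_pair.
split; last first.
  by rewrite -derive1E; apply/eqP; rewrite -subr_eq0; apply/eqP; exact: sol.
apply/derivable_mxP => i j; rewrite ord1; apply/derivable1_diffP.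
rewrite (_ : (fun s => _) = 'D_((0, 0), delta_mx 0 j) (uncurry3 L) \o c).
  apply: differentiable_comp dc _.
  exact: (smooth_differentiable (smooth_derive _ sL) (qU t It)).
by apply/funext => s; rewrite grad_dqE.
Qed.

Lemma mixed_derive_family (R : realType) n (W : set (R * R))
    (qe : R -> R -> 'rV[R]_n) p : open W -> smooth_on W (family qe) -> W p ->
  'D_(0, 1) (variation qe) p = 'D_(1, 0) (velocity qe) p.
Proof.
move=> Wo sq Wp.
have dq u : \forall y \near p, is_derive y u (family qe) ('D_u (family qe) y).
  apply: filterS (open_nbhs_nbhs (conj Wo Wp)) => y Wy.
  split => //; apply: diff_derivable; exact: smooth_differentiable sq Wy.
apply: (@mixed_derive_sym_rV R _ n (family qe)); [exact: dq|exact: dq| |].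
- exact: (smooth_differentiable (smooth_variation sq) Wp).
- exact: (smooth_differentiable (smooth_velocity sq) Wp).
Qed.

(** Product rule for momentum and variation: the Lagrange equations turn the
    derivative of the momentum into [grad_q L], and symmetry of the mixed
    derivatives turns that of the variation into [d/de velocity]. *)
Lemma is_derive_momentum_variation (R : realType) n
    (U : set (R * 'rV[R]_n * 'rV[R]_n)) (L : R -> 'rV[R]_n -> 'rV[R]_n -> R)
    (I : set R) (q : R -> 'rV[R]_n) (W : set (R * R))
    (qe : R -> R -> 'rV[R]_n) t :
  smooth_on U (uncurry3 L) -> smooth_on I q ->
  (forall t, I t -> U (t, q t, derive1 q t)) -> lagrange_solution L I q ->
  open W -> smooth_on W (family qe) ->
  I t -> W (0, t) -> qe 0 t = q t -> velocity qe (0, t) = derive1 q t ->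
  is_derive t 1
    (fun s => inner (grad_dq L s (q s) (derive1 q s)) (variation qe (0, s)))
    (lagrangian_variation L qe 0 t).
Proof.
move=> sL sq qU sol Wo sqe It Wt q0 v0.
rewrite /lagrangian_variation q0 v0 -(mixed_derive_family Wo sqe Wt).
apply: is_derive_inner; first exact: (is_derive_momentum sL sq qU sol It).
apply: is_derive_slice2.
exact: (smooth_differentiable (smooth_variation sqe) Wt).
Qed.

Unset Implicit Arguments.

(** * The first variation formula *)

Theorem lemma1 (R : realType) (n : nat) (n_gt0 : (0 < n)%N)
    (U : set (R * 'rV[R]_n * 'rV[R]_n)) (U_open : open U)
    (L : R -> 'rV[R]_n -> 'rV[R]_n -> R)
    (L_smooth : smooth_on U
       (fun p : R * 'rV[R]_n * 'rV[R]_n => L p.1.1 p.1.2 p.2))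
    (I : set R) (I_open : open I) (I_itv : is_interval I)
    (q : R -> 'rV[R]_n) (q_smooth : smooth_on I q)
    (q_dom : forall t, I t -> U (t, q t, derive1 q t))
    (qe : R -> R -> 'rV[R]_n) (qe_change : space_change I q qe)
    (a b : R) (Ia : I a) (Ib : I b)
    (q_sol : lagrange_solution L I q) :
  is_derive (0 : R) (1 : R) (fun e => hamiltonian_action L a b (qe e))
    (inner (grad_dq L b (q b) (derive1 q b)) (derive1 (fun e => qe e b) 0)
     - inner (grad_dq L a (q a) (derive1 q a)) (derive1 (fun e => qe e a) 0)).
Proof.
have [W [W_open W0 _ qe_smooth q0]] := qe_change.
have W0t t : I t -> W (0, t) by move=> It; exact: W0.
have v0 t : I t -> velocity qe (0, t) = derive1 q t.
  move=> It; rewrite -velocityE !derive1E; apply: near_eq_derive.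
  by apply: filterS (open_nbhs_nbhs (conj I_open It)) => s; exact: q0.
have U0 t : I t -> U (jet qe (0, t)).
  by move=> It; rewrite /jet /family /= q0 // v0 //; exact: q_dom.
pose G t := inner (grad_dq L t (q t) (derive1 q t)) (variation qe (0, t)).
have dG t : I t -> is_derive t 1 G (lagrangian_variation L qe 0 t).
  move=> It; exact: (is_derive_momentum_variation L_smooth q_smooth q_dom q_sol
    W_open qe_smooth It (W0t t It) (q0 t It) (v0 t It)).
have main c d : I c -> I d -> c <= d -> is_derive (0 : R) (1 : R)
    (fun e => \int[lebesgue_measure]_(t in `[c, d])
       L t (qe e t) (derive1 (qe e) t)) (G d - G c).
  move=> Ic Id cd.
  have Icd t : c <= t <= d -> I t by exact: (I_itv c d Ic Id).
  have -> : G d - G c =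
      \int[lebesgue_measure]_(t in `[c, d]) lagrangian_variation L qe 0 t.
    apply/esym/Rintegral_derivative => // t /Icd It; first exact: dG.
    have c0 : {for t, continuous (pair (0 : R))}.
      by apply: continuous_pair; [exact: cvg_cst|exact: cvg_id].
    exact: (continuous_comp c0 (continuous_lagrangian_variation
      L_smooth qe_smooth (W0t t It) (U0 t It))).
  under eq_fun do under eq_Rintegral do rewrite velocityE.
  apply: (is_derive_action U_open L_smooth W_open qe_smooth cd) => t /Icd It.
  by split; [exact: W0t|exact: U0].
rewrite !variationE -[inner _ _ - _]/(G b - G a).
rewrite /hamiltonian_action /oriented_integral.
case: (leP a b) => ab; first exact: main.
rewrite -opprB; apply: is_deriveN; apply: main => //; exact: ltW.
Qed.
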